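(* Let $M,n,d\in\mathbb{N}$ and let ${\bm{x}}_i^m\in\mathbb{R}^d$ ($m\in[M]$, $i\in[n]$) satisfy $\|{\bm{x}}_i^m\|\le 1$, and assume the data are linearly separable, i.e. there is ${\bm{w}}$ with $\langle {\bm{w}},{\bm{x}}_i^m\rangle>0$ for all $m,i$. Let $\gamma=\max_{\|{\bm{w}}\|=1}\min_{m,i}\langle {\bm{w}},{\bm{x}}_i^m\rangle>0$. Let $\ell(z)=\log(1+e^{-z})$, $F_m({\bm{w}})=\frac1n\sum_{i=1}^n\ell(\langle {\bm{w}},{\bm{x}}_i^m\rangle)$, $F=\frac1M\sum_{m=1}^M F_m$. Run Local GD with arbitrary ${\bm{w}}_0\in\mathbb{R}^d$, any $\eta>0$ and any $K\in\mathbb{N}$: ${\bm{w}}_{r,0}^m={\bm{w}}_r$, ${\bm{w}}_{r,k+1}^m={\bm{w}}_{r,k}^m-\eta\nabla F_m({\bm{w}}_{r,k}^m)$ for $k=0,\dots,K-1$, and ${\bm{w}}_{r+1}=\frac1M\sum_{m=1}^M{\bm{w}}_{r,K}^m$. Define $\psi=\min\left(\frac{\gamma}{140\eta KM},\frac{1}{2Mn}\right)$ and $$\tau=\frac{4\gamma\|{\bm{w}}_0\|+2\sqrt2+2\eta+\log\left(1+\frac{\sqrt K}{\sqrt\eta\,\gamma\psi}\right)}{\eta\gamma^2\psi}.$$ Then for every $r\ge\tau$, $$F({\bm{w}}_r)\le\frac{16}{\eta\gamma^2K(r-\tau)}.$$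
   Context: Distributed logistic regression with labels absorbed into the data (each data point ${\bm{x}}_i^m$ has label $+1$). $\|\cdot\|$ is the Euclidean norm. *)

(* Defs.v *)
From HB Require Import structures.
From mathcomp Require Import all_boot all_order all_algebra.
From mathcomp Require Import all_classical all_reals all_analysis.
Set Implicit Arguments. Unset Strict Implicit. Unset Printing Implicit Defensive.
Import Order.TTheory GRing.Theory Num.Theory.
Local Open Scope ring_scope.

Section LogReg.
Variable R : realType.

Definition dotv (d : nat) (u v : 'rV[R]_d) : R := \sum_(j < d) u 0 j * v 0 j.
Definition enorm (d : nat) (u : 'rV[R]_d) : R := Num.sqrt (dotv u u).

Definition logloss (z : R) : R := ln (1 + expR (- z)).
Definition dlogloss (z : R) : R := - (expR (- z) / (1 + expR (- z))).

Definition Floc (M n d : nat) (x : 'I_M -> 'I_n -> 'rV[R]_d) (m : 'I_M)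
  (w : 'rV[R]_d) : R :=
  (n%:R)^-1 * \sum_(i < n) logloss (dotv w (x m i)).

Definition gradFloc (M n d : nat) (x : 'I_M -> 'I_n -> 'rV[R]_d) (m : 'I_M)
  (w : 'rV[R]_d) : 'rV[R]_d :=
  (n%:R)^-1 *: \sum_(i < n) (dlogloss (dotv w (x m i)) *: x m i).

Definition Fglob (M n d : nat) (x : 'I_M -> 'I_n -> 'rV[R]_d) (w : 'rV[R]_d) : R :=
  (M%:R)^-1 * \sum_(m < M) Floc x m w.

Definition local_iter (M n d : nat) (x : 'I_M -> 'I_n -> 'rV[R]_d) (eta : R)
  (K : nat) (m : 'I_M) (w : 'rV[R]_d) : 'rV[R]_d :=
  iter K (fun v => v - eta *: gradFloc x m v) w.

Definition round (M n d : nat) (x : 'I_M -> 'I_n -> 'rV[R]_d) (eta : R)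
  (K : nat) (w : 'rV[R]_d) : 'rV[R]_d :=
  (M%:R)^-1 *: \sum_(m < M) local_iter x eta K m w.

Definition localGD (M n d : nat) (x : 'I_M -> 'I_n -> 'rV[R]_d) (eta : R)
  (K : nat) (w0 : 'rV[R]_d) (r : nat) : 'rV[R]_d :=
  iter r (round x eta K) w0.

Definition is_max_margin (M n d : nat) (x : 'I_M -> 'I_n -> 'rV[R]_d) (gamma : R) : Prop :=
  (exists w : 'rV[R]_d, enorm w = 1 /\ forall m i, gamma <= dotv w (x m i)) /\
  (forall w : 'rV[R]_d, enorm w = 1 -> exists m i, dotv w (x m i) <= gamma).

End LogReg.

(* Main.v *)
Require Import Defs.
From HB Require Import structures.
From mathcomp Require Import all_boot all_order all_algebra.
From mathcomp Require Import all_classical all_reals all_analysis.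
From mathcomp Require Import ring lra.
Import Order.TTheory GRing.Theory Num.Theory.
Local Open Scope ring_scope.

(** Let [ws] be the unit vector of maximal margin and [u = U ws].  While the loss
    of the averaged iterate exceeds [7 psi], either some point is misclassified,
    in which case its slope is at least 1/2 and it does not push the iterate away
    from the origin, or all points are classified correctly and the average slope
    is at least [14/3 psi].  In both cases [|w_r - u|^2] drops in the round by at
    least a fixed amount, so for a suitable length [U], logarithmic in [K / psi],
    some round [s <= tau] has loss at most [7 psi].  From then on a client moves by
    at most a small multiple of [gamma] in a round, the slopes are almost constant,
    and the round is a gradient step of size [eta K] with a small relative error.
    The slopes dominate a multiple of the losses, hence
    [F_(r+1) <= F_r - eta K gamma^2 F_r^2 / 16]. *)

(** * Inner product, norm and averages of vectors *)

Section EuclideanNorm.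
Context {R : realType} {d : nat}.
Implicit Types u v w : 'rV[R]_d.

Lemma dotvC u v : dotv u v = dotv v u.
Proof. by apply: eq_bigr => j _; rewrite mulrC. Qed.

Lemma dotvDl u v w : dotv (u + v) w = dotv u w + dotv v w.
Proof. by rewrite -big_split; apply: eq_bigr => j _; rewrite mxE mulrDl. Qed.

Lemma dotvZl a u v : dotv (a *: u) v = a * dotv u v.
Proof. by rewrite mulr_sumr; apply: eq_bigr => j _; rewrite mxE mulrA. Qed.

Lemma dotvNl u v : dotv (- u) v = - dotv u v.
Proof. by rewrite -scaleN1r dotvZl mulN1r. Qed.

Lemma dotvDr u v w : dotv w (u + v) = dotv w u + dotv w v.
Proof. by rewrite !(dotvC w) dotvDl. Qed.

Lemma dotvZr a u v : dotv v (a *: u) = a * dotv v u.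
Proof. by rewrite !(dotvC v) dotvZl. Qed.

Lemma dotvNr u v : dotv v (- u) = - dotv v u.
Proof. by rewrite !(dotvC v) dotvNl. Qed.

Lemma dotv_suml k (f : 'I_k -> 'rV[R]_d) v :
  dotv (\sum_i f i) v = \sum_i dotv (f i) v.
Proof.
rewrite /dotv exchange_big; apply: eq_bigr => j _.
by rewrite summxE mulr_suml.
Qed.

Lemma dotvv_ge0 u : 0 <= dotv u u.
Proof. by apply: sumr_ge0 => j _; rewrite -expr2 sqr_ge0. Qed.

Lemma enorm_ge0 u : 0 <= enorm u.
Proof. exact: sqrtr_ge0. Qed.

Lemma sqr_enorm u : enorm u ^+ 2 = dotv u u.
Proof. by rewrite sqr_sqrtr // dotvv_ge0. Qed.

Lemma enorm_eq0 u v : enorm u = 0 -> dotv u v = 0.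
Proof.
move=> u0; have /eqP := sqr_enorm u; rewrite u0 expr0n /= eq_sym.
rewrite psumr_eq0 => [/allP uu0|j _]; last by rewrite -expr2 sqr_ge0.
apply: big1 => j _; have /eqP/eqP := uu0 j (mem_index_enum _).
by rewrite mulf_eq0 orbb => /eqP ->; rewrite mul0r.
Qed.

Lemma cauchy_schwarz u v : dotv u v <= enorm u * enorm v.
Proof.
have [u0|u0] := eqVneq (enorm u) 0; first by rewrite enorm_eq0 // u0 mul0r.
have [v0|v0] := eqVneq (enorm v) 0.
  by rewrite dotvC enorm_eq0 // v0 mulr0.
have uv_gt0 : 0 < enorm u * enorm v.
  by rewrite mulr_gt0 // lt_neqAle eq_sym ?u0 ?v0 enorm_ge0.
have := dotvv_ge0 (enorm v *: u - enorm u *: v).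
rewrite !(dotvDl, dotvDr, dotvNl, dotvNr, dotvZl, dotvZr) (dotvC v u) -!sqr_enorm.
by move=> h; rewrite -(ler_pM2l uv_gt0); lra.
Qed.

Lemma enormN u : enorm (- u) = enorm u.
Proof. by rewrite /enorm dotvNl dotvNr opprK. Qed.

Lemma abs_dotv_le u v : `|dotv u v| <= enorm u * enorm v.
Proof.
by rewrite ler_norml cauchy_schwarz lerNl -dotvNl -(enormN u) cauchy_schwarz.
Qed.

Lemma enormZ a u : enorm (a *: u) = `|a| * enorm u.
Proof.
by rewrite /enorm dotvZl dotvZr mulrA -expr2 sqrtrM ?sqr_ge0 // sqrtr_sqr.
Qed.

Lemma sqr_enormD u v :
  enorm (u + v) ^+ 2 = enorm u ^+ 2 + 2 * dotv u v + enorm v ^+ 2.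
Proof. by rewrite !sqr_enorm !(dotvDl, dotvDr) (dotvC v u); lra. Qed.

Lemma enorm0 : enorm (0 : 'rV[R]_d) = 0.
Proof. by rewrite -(scale0r 0) enormZ normr0 mul0r. Qed.

Lemma enorm_triangle u v : enorm (u + v) <= enorm u + enorm v.
Proof.
rewrite -ler_sqr ?nnegrE ?addr_ge0 ?enorm_ge0 // sqr_enormD sqrrD.
have := cauchy_schwarz u v; lra.
Qed.

Lemma enorm_avg_le k (f : 'I_k -> 'rV[R]_d) (c : 'I_k -> R) :
  (forall i, enorm (f i) <= c i) ->
  enorm (k%:R^-1 *: \sum_i f i) <= k%:R^-1 * \sum_i c i.
Proof.
move=> fc; rewrite enormZ ger0_norm ?invr_ge0 ?ler0n //.
apply: ler_wpM2l; first by rewrite invr_ge0 ler0n.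
elim/big_ind2: _ => [|u a v b ua vb|i _]; last exact: fc.
  by rewrite enorm0.
exact: le_trans (enorm_triangle _ _) (lerD ua vb).
Qed.

Lemma avg_le k (f g : 'I_k -> R) :
  (forall i, f i <= g i) -> k%:R^-1 * \sum_i f i <= k%:R^-1 * \sum_i g i.
Proof.
by move=> fg; rewrite ler_wpM2l ?invr_ge0 ?ler0n // ler_sum.
Qed.

Lemma avg_const k (c : R) : (0 < k)%N -> k%:R^-1 * \sum_(i < k) c = c.
Proof.
move=> k0; rewrite sumr_const card_ord -[c *+ k]mulr_natl mulrA mulVf ?mul1r //.
by rewrite pnatr_eq0 -lt0n.
Qed.

Lemma avg_ge k (f : 'I_k -> R) i :
  (forall j, 0 <= f j) -> k%:R^-1 * f i <= k%:R^-1 * \sum_j f j.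
Proof.
move=> f0; rewrite ler_wpM2l ?invr_ge0 ?ler0n // (bigD1 i) //= lerDl.
exact: sumr_ge0.
Qed.

Lemma avgB k (f : 'I_k -> 'rV[R]_d) w : (0 < k)%N ->
  k%:R^-1 *: \sum_i f i - w = k%:R^-1 *: \sum_i (f i - w).
Proof.
move=> k0; rewrite big_split /= scalerDr; congr (_ + _).
rewrite sumr_const card_ord -[- w *+ k]scaler_nat scalerA mulVf ?scale1r //.
by rewrite pnatr_eq0 -lt0n.
Qed.

(** Jensen for the square: with [m] the average, its squared norm is the average of
    [2 * dotv (f i) m - enorm m ^+ 2], and each term is at most [enorm (f i) ^+ 2] because [f i - m]
    has nonnegative squared norm. *)
Lemma sqr_enorm_avg_le k (f : 'I_k -> 'rV[R]_d) : (0 < k)%N ->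
  enorm (k%:R^-1 *: \sum_i f i) ^+ 2 <= k%:R^-1 * \sum_i enorm (f i) ^+ 2.
Proof.
move=> k0; set m := _ *: _.
have -> : enorm m ^+ 2 = k%:R^-1 * \sum_i (2 * dotv (f i) m - enorm m ^+ 2).
  rewrite big_split /= mulrDr -[X in _ + _ * X]mulr1 -mulr_sumr.
  rewrite mulrCA -dotv_suml -dotvZl -sqr_enorm mulr1 avg_const //; lra.
apply: avg_le => i; have := sqr_ge0 (enorm (f i - m)).
rewrite sqr_enormD enormN dotvNr; lra.
Qed.

End EuclideanNorm.

(** * The logistic loss, its slope, and how they compare *)

Section LogisticLoss.
Context {R : realType}.
Implicit Types s t u z : R.

(** Convexity: the tangent at [t * s], evaluated at [0] and at [s], is averaged with weights [1 - t]
    and [t]. *)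
Lemma expR_chord s t : 0 <= t <= 1 -> expR (t * s) <= 1 - t + t * expR s.
Proof.
move=> /andP[t0 t1]; have e0 := expR_gt0 (t * s).
have es : expR s = expR (t * s) * expR (s - t * s).
  by rewrite -expRD; congr expR; ring.
have e1 : 1 = expR (t * s) * expR (- (t * s)) by rewrite -expRD subrr expR0.
have a1 : expR (t * s) * (1 - t * s) <= 1.
  by rewrite [leRHS]e1 ler_pM2l // expR_ge1Dx.
have a2 : expR (t * s) * (1 + (s - t * s)) <= expR s.
  by rewrite [leRHS]es ler_pM2l // expR_ge1Dx.
have := ler_wpM2l t0 a2; have : (1 - t) * (expR (t * s) * (1 - t * s)) <= 1 - t.
  by rewrite ler_piMr // subr_ge0.
lra.
Qed.

Lemma expR_sub1_le t : 0 <= t < 1 -> expR t - 1 <= t / (1 - t).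
Proof.
move=> /andP[t0 t1]; have := expR_ge1Dx (- t); rewrite expRN => h.
have -> : t / (1 - t) = (1 - t)^-1 - 1 by field; lra.
by rewrite lerD2r -[expR t]invrK lef_pV2 // ?posrE ?invr_gt0 ?expR_gt0 //; lra.
Qed.

Definition slope z : R := - dlogloss z.

Lemma slopeE z : slope z = (1 + expR z)^-1.
Proof.
rewrite /slope /dlogloss opprK expRN; have := expR_gt0 z => e0.
by field; rewrite !gt_eqF //; lra.
Qed.

Lemma slope_gt0 z : 0 < slope z.
Proof. by rewrite slopeE invr_gt0; have := expR_gt0 z; lra. Qed.

Lemma slope_le1 z : slope z <= 1.
Proof. by rewrite slopeE invf_le1; have := expR_gt0 z; lra. Qed.

Lemma slope_ge_half z : z < 0 -> 1 / 2 <= slope z.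
Proof.
move=> z0; rewrite slopeE div1r lef_pV2 ?posrE; first last.
- by [].
- by have := expR_gt0 z; lra.
by have := expR_lt1 z; rewrite z0; lra.
Qed.

Lemma slope_le_expR z : slope z <= expR (- z).
Proof.
rewrite slopeE expRN lef_pV2 ?posrE ?expR_gt0 //; have := expR_gt0 z; lra.
Qed.

Lemma logloss_gt0 z : 0 < logloss z.
Proof. by rewrite ln_gt0 //; have := expR_gt0 (- z); lra. Qed.

(** Exhibits the slope as a concave function of the loss, so comparing the two reduces to bounds on
    the exponential. *)
Lemma slope_logloss z : slope z = 1 - expR (- logloss z).
Proof.
have e0 := expR_gt0 (- z).
rewrite /slope /dlogloss opprK (expRN (logloss z)) lnK ?posrE; last lra.
by field; lra.
Qed.

Lemma slope_le_logloss z : slope z <= logloss z.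
Proof. by rewrite slope_logloss; have := expR_ge1Dx (- logloss z); lra. Qed.

(** By concavity in the loss, the slope lies above its chord over [[0, U]]; [q] stands for a
    rational bound on [expR (- U)]. *)
Lemma slope_ge_logloss (U q z : R) : 0 < U -> expR (- U) <= q ->
  logloss z <= U -> (1 - q) / U * logloss z <= slope z.
Proof.
move=> U0 Uq zU; rewrite slope_logloss.
have l0 := ltW (logloss_gt0 z); set l := logloss z in zU l0 *.
have := @expR_chord (- U) (l / U).
rewrite ler_pdivlMr // mul0r l0 ler_pdivrMr // mul1r zU => /(_ isT).
rewrite mulrN divfK ?gt_eqF //.
have : l / U * expR (- U) <= l / U * q.
  by rewrite ler_wpM2l // divr_ge0 // ltW.
have -> : (1 - q) / U * l = l / U - l / U * q by field; lra.
lra.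
Qed.

Lemma expR_ge (m : nat) z (a : R) : 0 <= 1 + a -> z = a *+ m -> (1 + a) ^+ m <= expR z.
Proof.
move=> a0 ->; rewrite -mulr_natr expRM_natr lerXn2r ?nnegrE ?expR_ge0 //.
exact: expR_ge1Dx.
Qed.

Lemma ln2_le : ln 2 <= 3 / 4 :> R.
Proof.
rewrite -[leRHS]expRK ler_ln ?posrE ?expR_gt0 //.
apply: le_trans (@expR_ge 8 _ (3 / 32) _ _); try lra.
Qed.

Lemma expRN_le (m : nat) z (a q : R) : 0 <= 1 + a -> z = a *+ m ->
  0 < q -> q^-1 <= (1 + a) ^+ m -> expR (- z) <= q.
Proof.
move=> a0 za q0 qa; rewrite expRN -[q]invrK lef_pV2 ?posrE ?invr_gt0 ?expR_gt0 //.
exact: le_trans qa (expR_ge _ _ _ a0 za).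
Qed.

Lemma ln2_ge : 3 / 5 <= ln 2 :> R.
Proof.
rewrite -[leLHS]expRK ler_ln ?posrE ?expR_gt0 // -[3 / 5]opprK.
apply: (@expRN_le 4 _ (- (3 / 20))); lra.
Qed.

Lemma logloss_le_slope_nonneg z : 0 <= z -> logloss z <= 3 / 2 * slope z.
Proof.
move=> z0; have : (1 - 1 / 2) / (3 / 4) * logloss z <= slope z; last lra.
apply: slope_ge_logloss => //.
  apply: (@expRN_le 8 _ (3 / 32)); try lra.
apply: le_trans ln2_le; rewrite /logloss.
have e0 := expR_gt0 (- z).
rewrite ler_ln ?posrE ?addr_gt0 ?expR_gt0 //.
have := expR_le1 (- z); rewrite oppr_le0 z0; lra.
Qed.

(** The value [7 / 2] bounds the loss of every single point once the global loss is at most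
    [7 * psi], as [psi <= 1 / (2 * M * n)]. *)
Lemma logloss_le_slope_bounded z :
  logloss z <= 7 / 2 -> 27 / 100 * logloss z <= slope z.
Proof.
move=> zU; have : (1 - 11 / 200) / (7 / 2) * logloss z <= slope z; last lra.
apply: slope_ge_logloss => //.
apply: (@expRN_le 14 _ (1 / 4)); try lra.
Qed.

(** Bounds how far one point pushes the iterate outwards. For negative [z] the left side is
    nonpositive and the slope at least 1/2; up to [lam] the claim is immediate; beyond, multiply
    [slope z <= expR (- z)] by [z - lam <= expR (z - lam - 1)]. *)
Lemma slope_mul_le (lam z : R) : 0 <= lam ->
  slope z * z <= lam * (slope z - (z < 0)%R%:R / 2) + expR (- lam - 1).
Proof.
move=> lam0; have s0 := slope_gt0 z; have e0 := expR_gt0 (- lam - 1).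
have [z0|z0] := ltP z 0.
  have := slope_ge_half z z0; have : slope z * z <= 0 by nra.
  rewrite /=; nra.
rewrite mul0r subr0; have [zl|zl] := leP z lam; first by nra.
have : slope z * (z - lam) <= expR (- z) * expR (z - lam - 1).
  apply: ler_pM; [lra|lra|exact: slope_le_expR|].
  by have := expR_ge1Dx (z - lam - 1); lra.
by rewrite -expRD (_ : - z + _ = - lam - 1); [nra|ring].
Qed.

(** The logarithm of the slope is 1-Lipschitz; hence gradient changes can be measured relative to
    the slope itself. *)
Lemma slope_shift_le (z z' D : R) : `|z' - z| <= D ->
  slope z' <= expR D * slope z.
Proof.
move=> zD; have := zD; rewrite ler_norml => /andP[h _]; rewrite !slopeE.
have e0 := expR_gt0 z; have e0' := expR_gt0 z'; have eD := expR_gt0 D.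
rewrite ler_pdivlMr ?ler_pdivrMl ?addr_gt0 //.
have : expR z <= expR D * expR z' by rewrite -expRD ler_expR; lra.
by have := expR_ge1Dx D; have := le_trans (normr_ge0 _) zD; nra.
Qed.

Lemma slope_lip (z z' D : R) : `|z' - z| <= D ->
  `|slope z' - slope z| <= (expR D - 1) * slope z.
Proof.
move=> h; have D0 : 0 <= D := le_trans (normr_ge0 _) h.
have h1 := slope_shift_le _ _ _ h; rewrite distrC in h.
have h2 := slope_shift_le _ _ _ h.
have s0 := slope_gt0 z; have s0' := slope_gt0 z'.
have eD := expR_ge1Dx D.
rewrite ler_norml; apply/andP; split; nra.
Qed.

(** Exponentiated, this tangent inequality is [expR_chord] with weight [slope z']. *)
Lemma logloss_convex (z z' : R) : logloss z' - logloss z <= - slope z' * (z' - z).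
Proof.
have e0 := expR_gt0 (- z); have e0' := expR_gt0 (- z').
have : slope z' * (z' - z) <= logloss z - logloss z'; last lra.
rewrite /logloss -ln_div ?posrE; try lra.
rewrite -[leLHS]expRK ler_ln ?posrE ?expR_gt0 ?divr_gt0 ?addr_gt0 ?expR_gt0 //.
have := @expR_chord (z' - z) (slope z').
rewrite slope_le1 ltW ?slope_gt0 // => /(_ isT) /le_trans; apply.
rewrite expRD /slope /dlogloss opprK (expRN z').
have := expR_gt0 z' => e1.
rewrite le_eqVlt; apply/orP; left; apply/eqP; field; rewrite !gt_eqF //; lra.
Qed.

End LogisticLoss.

(** * Client and global averages of losses, slopes and gradients *)

Section LocalGradientDescent.
Context {R : realType} {M n d : nat} {x : 'I_M -> 'I_n -> 'rV[R]_d}.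
Context (M0 : (0 < M)%N) (n0 : (0 < n)%N).
Context (x1 : forall m i, enorm (x m i) <= 1).
Implicit Types (u v w : 'rV[R]_d) (m : 'I_M) (i : 'I_n).

Definition Gloc m w : R := n%:R^-1 * \sum_(i < n) slope (dotv w (x m i)).

Definition Gglob w : R := M%:R^-1 * \sum_(m < M) Gloc m w.

(** Half the fraction of misclassified points; the half is the lower bound on their slopes. *)
Definition misloc m w : R :=
  n%:R^-1 * \sum_(i < n) (dotv w (x m i) < 0)%R%:R / 2.

Definition gradFglob w : 'rV[R]_d := M%:R^-1 *: \sum_(m < M) gradFloc x m w.

Lemma dotv_gradFloc m w v :
  dotv (gradFloc x m w) v =
  n%:R^-1 * \sum_(i < n) - slope (dotv w (x m i)) * dotv (x m i) v.
Proof.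
rewrite dotvZl dotv_suml; congr (_ * _); apply: eq_bigr => i _.
by rewrite dotvZl /slope opprK.
Qed.

Lemma Gloc_ge0 m w : 0 <= Gloc m w.
Proof.
rewrite mulr_ge0 ?invr_ge0 ?ler0n //; apply: sumr_ge0 => i _.
exact/ltW/slope_gt0.
Qed.

Lemma Gloc_le1 m w : Gloc m w <= 1.
Proof.
by rewrite -[leRHS](avg_const n 1 n0); apply: avg_le => i; exact: slope_le1.
Qed.

Lemma Gglob_ge0 w : 0 <= Gglob w.
Proof.
by rewrite mulr_ge0 ?invr_ge0 ?ler0n //; apply: sumr_ge0 => m _; exact: Gloc_ge0.
Qed.

Lemma misloc_ge0 m w : 0 <= misloc m w.
Proof.
rewrite mulr_ge0 ?invr_ge0 ?ler0n //; apply: sumr_ge0 => i _.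
by rewrite divr_ge0.
Qed.

Lemma Floc_ge0 m w : 0 <= Floc x m w.
Proof.
rewrite mulr_ge0 ?invr_ge0 ?ler0n //; apply: sumr_ge0 => i _.
exact/ltW/logloss_gt0.
Qed.

Lemma Gloc_le_Floc m w : Gloc m w <= Floc x m w.
Proof. by apply: avg_le => i; exact: slope_le_logloss. Qed.

Lemma Fglob_ge0 w : 0 <= Fglob x w.
Proof.
by rewrite mulr_ge0 ?invr_ge0 ?ler0n //; apply: sumr_ge0 => m _; exact: Floc_ge0.
Qed.

Lemma Floc_le_Fglob m w : Floc x m w <= M%:R * Fglob x w.
Proof.
have M0' : 0 < M%:R :> R by rewrite ltr0n.
rewrite -ler_pdivrMl //; apply: (avg_ge M (Floc x ^~ w)) => j; exact: Floc_ge0.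
Qed.

Lemma logloss_le_Fglob m i w :
  logloss (dotv w (x m i)) <= M%:R * n%:R * Fglob x w.
Proof.
have n0' : 0 < n%:R :> R by rewrite ltr0n.
rewrite -mulrA mulrCA -ler_pdivrMl //; apply: le_trans (Floc_le_Fglob m w).
apply: (avg_ge n (fun i => logloss (dotv w (x m i)))) => j.
exact/ltW/logloss_gt0.
Qed.

Lemma Fglob_le_Gglob (c : R) w :
  (forall m i, c * logloss (dotv w (x m i)) <= slope (dotv w (x m i))) ->
  c * Fglob x w <= Gglob w.
Proof.
move=> h; rewrite /Fglob mulrCA mulr_sumr; apply: avg_le => m.
by rewrite /Floc mulrCA mulr_sumr; apply: avg_le => i.
Qed.

Lemma enorm_gradFloc_le m w : enorm (gradFloc x m w) <= Gloc m w.
Proof.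
apply: enorm_avg_le => i; rewrite enormZ -normrN -/(slope _).
rewrite gtr0_norm ?slope_gt0 // ler_piMr ?x1 //; exact/ltW/slope_gt0.
Qed.

Lemma enorm_gradFglob_le w : enorm (gradFglob w) <= Gglob w.
Proof. by apply: enorm_avg_le => m; exact: enorm_gradFloc_le. Qed.

Lemma abs_dotv_data w v m i : `|dotv w (x m i) - dotv v (x m i)| <= enorm (w - v).
Proof.
rewrite -dotvNl -dotvDl; apply: le_trans (abs_dotv_le _ _) _.
by rewrite ler_piMr ?enorm_ge0.
Qed.

Lemma enorm_gradFloc_sub_le m w v :
  enorm (gradFloc x m v - gradFloc x m w)
  <= (expR (enorm (v - w)) - 1) * Gloc m w.
Proof.
rewrite /gradFloc -scalerBr -sumrB /Gloc mulrCA mulr_sumr.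
apply: enorm_avg_le => i; rewrite -scalerBl enormZ.
apply: le_trans (slope_lip _ _ _ (abs_dotv_data v w m i)).
by rewrite /slope -[X in _ <= `|X|]opprD normrN ler_piMr.
Qed.

Lemma enorm_gradFglob_sub_le w v :
  enorm (gradFglob v - gradFglob w) <= (expR (enorm (v - w)) - 1) * Gglob w.
Proof.
rewrite /gradFglob -scalerBr -sumrB /Gglob mulrCA mulr_sumr.
by apply: enorm_avg_le => m; exact: enorm_gradFloc_sub_le.
Qed.

Lemma Fglob_convex v w : Fglob x v - Fglob x w <= dotv (gradFglob v) (v - w).
Proof.
rewrite /gradFglob dotvZl dotv_suml /Fglob -mulrBr -sumrB; apply: avg_le => m.
rewrite dotv_gradFloc /Floc -mulrBr -sumrB; apply: avg_le => i.
rewrite (dotvC (x m i)) dotvDl dotvNl; exact: logloss_convex.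
Qed.

(** * A unit direction of margin [gamma], and rounds close to gradient steps *)

Section Comparator.
Context (eta gamma : R) (K : nat) (ws : 'rV[R]_d).
Context (eta0 : 0 < eta) (gamma0 : 0 < gamma) (K0 : (0 < K)%N).
Context (ws1 : enorm ws = 1) (wsx : forall m i, gamma <= dotv ws (x m i)).

Lemma dotv_gradFloc_ws m w : dotv (gradFloc x m w) ws <= - gamma * Gloc m w.
Proof.
rewrite dotv_gradFloc /Gloc mulrCA [X in _ <= _ * X]mulr_sumr; apply: avg_le => i.
have := slope_gt0 (dotv w (x m i)); have := wsx m i; rewrite (dotvC ws); nra.
Qed.

(** Testing the gradient against [ws] makes its norm and the average slope comparable up to the
    factor [gamma]. *)
Lemma enorm_gradFglob_ge w : gamma * Gglob w <= enorm (gradFglob w).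
Proof.
rewrite -enormN -[leRHS]mulr1 -ws1; apply: le_trans (cauchy_schwarz _ _).
rewrite dotvNl lerNr dotvZl dotv_suml /Gglob -mulNr mulrCA [X in _ <= _ * X]mulr_sumr.
by apply: avg_le => m; exact: dotv_gradFloc_ws.
Qed.

(** Induction on [k]: while the client stays near [w], each gradient differs from the one at [w] by
    at most [3 / 50 * gamma * Gloc m w], so the errors add up linearly. *)
Lemma local_iter_drift m w k : gamma <= 1 ->
  eta * K%:R * Gloc m w <= gamma / 20 -> (k <= K)%N ->
  enorm (local_iter x eta k m w - w + (eta * k%:R) *: gradFloc x m w)
  <= 3 / 50 * gamma * (eta * k%:R * Gloc m w).
Proof.
move=> gamma1 small; have G0 := Gloc_ge0 m w.
elim: k => [_|k IH kK].
  by rewrite /local_iter /= subrr mulr0 scale0r addr0 enorm0 !(mul0r, mulr0).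
have := IH (ltnW kK); rewrite /local_iter iterS.
set v := iter _ _ _; set e := _ + _ => He.
have -> : v - eta *: gradFloc x m v - w + (eta * k.+1%:R) *: gradFloc x m w
          = e - eta *: (gradFloc x m v - gradFloc x m w).
  rewrite /e -natr1 mulrDr mulr1 scalerDl scalerBr opprB.
  by rewrite [eta *: _ - _]addrC !addrA -!(addrAC _ (- w)) -!(addrAC _ (- (eta *: _))).
have kK' : eta * k%:R * Gloc m w <= gamma / 20.
  apply: le_trans small; rewrite ler_wpM2r // ler_wpM2l ?(ltW eta0) //.
  by rewrite ler_nat ltnW.
have ek0 : 0 <= eta * k%:R by rewrite mulr_ge0 // ltW.
have D0 := enorm_ge0 (v - w).
have He' : enorm e <= 3 / 50 * (eta * k%:R * Gloc m w).
  apply: le_trans He _.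
  have := ler_wpM2r (mulr_ge0 ek0 G0) gamma1; lra.
have HD : enorm (v - w) <= 53 / 1000 * gamma.
  have -> : v - w = e - (eta * k%:R) *: gradFloc x m w by rewrite addrK.
  apply: le_trans (enorm_triangle _ _) _; rewrite enormN enormZ ger0_norm //.
  have := ler_wpM2l ek0 (enorm_gradFloc_le m w); lra.
(* The induction closes because [D <= 53 / 1000 * gamma] and [gamma <= 1] give
   [D / (1 - D) <= 53 / 947 * gamma], below [3 / 50 * gamma]. *)
have Hg : enorm (gradFloc x m v - gradFloc x m w) <= 3 / 50 * gamma * Gloc m w.
  apply: le_trans (enorm_gradFloc_sub_le _ _ _) _; rewrite ler_wpM2r //.
  apply: le_trans (expR_sub1_le _ _) _; first by apply/andP; split; lra.
  rewrite ler_pdivrMr; [nra|lra].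
apply: le_trans (enorm_triangle _ _) _.
rewrite enormN enormZ gtr0_norm // -natr1.
have := ler_wpM2l (ltW eta0) Hg; lra.
Qed.

(** The tangent at the new iterate bounds the change of loss by the new gradient times the
    displacement. In units of [eta * K * enorm (gradFglob w) ^+ 2], the old gradient contributes at
    most [- 47 / 50] and the change of gradient at most [3 / 50]. *)
Lemma round_descent w : gamma <= 1 ->
  (forall m, eta * K%:R * Gloc m w <= gamma / 20) ->
  Fglob x (round x eta K w)
  <= Fglob x w - 22 / 25 * (eta * K%:R) * enorm (gradFglob w) ^+ 2.
Proof.
move=> gamma1 small; set a := eta * K%:R.
have a0 : 0 < a by rewrite mulr_gt0 // ltr0n.
have G0 := Gglob_ge0 w; have N0 := enorm_ge0 (gradFglob w).
have NG := enorm_gradFglob_ge w; have GN := enorm_gradFglob_le w.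
have aG : a * Gglob w <= gamma / 20.
  rewrite /Gglob mulrCA mulr_sumr -[leRHS](avg_const M _ M0); exact: avg_le.
set D := round x eta K w - w; set e := D + a *: gradFglob w.
(* The factor [gamma] in the drift bound converts the average slope into the gradient norm. *)
have He : enorm e <= 3 / 50 * a * enorm (gradFglob w).
  have -> : e = M%:R^-1 *: \sum_m
      (local_iter x eta K m w - w + a *: gradFloc x m w).
    rewrite /e /D /round avgB // /gradFglob scalerA mulrC -scalerA -scalerDr.
    by rewrite scaler_sumr -big_split.
  have drift m := local_iter_drift m w K gamma1 (small m) (leqnn K).
  apply: le_trans (enorm_avg_le _ _ _ drift) _.
  rewrite -mulr_sumr -mulr_sumr mulrCA [X in _ * X]mulrCA -/(Gglob w) -/a.
  have := ler_wpM2l (ltW a0) NG; lra.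
have De : D = e - a *: gradFglob w by rewrite addrK.
have D0 := enorm_ge0 D.
have HD : enorm D <= 53 / 50 * (a * enorm (gradFglob w)).
  rewrite De; apply: le_trans (enorm_triangle _ _) _.
  rewrite enormN enormZ gtr0_norm //; lra.
have HD' : enorm D <= 53 / 1000.
  have := ler_wpM2l (ltW a0) GN; lra.
have := Fglob_convex (round x eta K w) w; rewrite -/D.
rewrite -[gradFglob (round _ _ _ _)](subrK (gradFglob w)) dotvDl.
have := cauchy_schwarz (gradFglob (round x eta K w) - gradFglob w) D.
have := enorm_gradFglob_sub_le w (round x eta K w); rewrite -/D.
set P := enorm (gradFglob _ - _).
have : expR (enorm D) - 1 <= 53 / 50 * enorm D.
  apply: le_trans (expR_sub1_le _ _) _; first by apply/andP; split; lra.
  rewrite ler_pdivrMr; [nra|lra].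
move=> /(ler_wpM2r G0) h1 h2 /le_trans h3.
have := h3 _ (ler_wpM2r D0 (le_trans h2 h1)).
have : dotv (gradFglob w) D
    <= - (47 / 50) * a * enorm (gradFglob w) ^+ 2.
  rewrite De dotvDr dotvNr dotvZr -sqr_enorm.
  have := cauchy_schwarz (gradFglob w) e; have := ler_wpM2l N0 He; lra.
(* Uses [a * Gglob w <= 1 / 20] and [(53 / 50) ^+ 3 / 20 < 3 / 50]. *)
have : 53 / 50 * enorm D * Gglob w * enorm D
    <= 3 / 50 * a * enorm (gradFglob w) ^+ 2.
  have DD : enorm D ^+ 2 <= (53 / 50 * (a * enorm (gradFglob w))) ^+ 2.
    by rewrite lerXn2r ?nnegrE // mulr_ge0 // mulr_ge0 // ltW.
  have := ler_wpM2r G0 DD.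
  have aN0 : 0 <= a * enorm (gradFglob w) ^+ 2 by rewrite mulr_ge0 ?sqr_ge0 // ltW.
  have := ler_wpM2l aN0 (le_trans aG (_ : gamma / 20 <= 1 / 20)).
  by move=> /(_ ltac:(lra)); lra.
lra.
Qed.

(** The smallness asked by [round_descent] is [7 / 140 = 1 / 20], and the final constant is
    [22 / 25 * (27 / 100) ^+ 2 > 1 / 16]. *)
Lemma round_descent_stable (psi : R) w : gamma <= 1 ->
  psi <= gamma / (140 * eta * K%:R * M%:R) -> psi <= 1 / (2 * M%:R * n%:R) ->
  Fglob x w <= 7 * psi ->
  Fglob x (round x eta K w)
  <= Fglob x w - eta * K%:R * gamma ^+ 2 / 16 * Fglob x w ^+ 2.
Proof.
move=> gamma1 psi1 psi2 Fpsi.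
have M0' : 0 < M%:R :> R by rewrite ltr0n.
have n0' : 0 < n%:R :> R by rewrite ltr0n.
have K0' : 0 < K%:R :> R by rewrite ltr0n.
have a0 : 0 < eta * K%:R by rewrite mulr_gt0.
have psi1' : 140 * (eta * K%:R * M%:R * psi) <= gamma.
  by move: psi1; rewrite ler_pdivlMr ?mulr_gt0 //; lra.
have psi2' : 2 * (M%:R * n%:R * psi) <= 1.
  by move: psi2; rewrite ler_pdivlMr ?mulr_gt0 //; lra.
apply: le_trans (round_descent w gamma1 _) _ => [m|].
  apply: le_trans (ler_wpM2l (ltW a0) (Gloc_le_Floc m w)) _.
  apply: le_trans (ler_wpM2l (ltW a0) (Floc_le_Fglob m w)) _.
  have := ler_wpM2l (ltW (mulr_gt0 a0 M0')) Fpsi; lra.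
have FG : 27 / 100 * Fglob x w <= Gglob w.
  apply: Fglob_le_Gglob => m i; apply: logloss_le_slope_bounded.
  apply: le_trans (logloss_le_Fglob m i w) _.
  have := ler_wpM2l (ltW (mulr_gt0 M0' n0')) Fpsi; lra.
have F0 := Fglob_ge0 w.
have h : (27 / 100 * gamma * Fglob x w) ^+ 2 <= enorm (gradFglob w) ^+ 2.
  have gF0 := mulr_ge0 (ltW gamma0) F0.
  rewrite lerXn2r ?nnegrE ?enorm_ge0 //; first lra.
  apply: le_trans (enorm_gradFglob_ge w); have := ler_wpM2l (ltW gamma0) FG; lra.
have := ler_wpM2l (ltW a0) h.
have : 0 <= eta * K%:R * (gamma * Fglob x w) ^+ 2.
  by rewrite mulr_ge0 ?sqr_ge0 // ltW.
lra.
Qed.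

(** * Squared distance to the comparator [U *: ws] *)

Lemma dotv_gradFloc_self (lam : R) m w : 0 <= lam ->
  - dotv (gradFloc x m w) w <= lam * (Gloc m w - misloc m w) + expR (- lam - 1).
Proof.
move=> lam0; rewrite dotv_gradFloc /Gloc /misloc -mulrBr -sumrB mulrCA.
rewrite [X in _ <= _ * X + _]mulr_sumr -[expR _](avg_const n _ n0).
rewrite -mulrDr -big_split /= -mulrN -sumrN.
apply: avg_le => i; rewrite mulNr opprK dotvC; exact: slope_mul_le.
Qed.

Context (lam U : R) (lam0 : 0 <= lam) (U0 : 0 <= U).
(* With this length of the comparator, its inner product with the gradient
   cancels the second order term and the growth due to correctly classified
   points, up to the gain [11 / 50 * lam] per unit of slope. *)
Context (Ug : U * gamma = 61 / 50 * lam + eta / 2).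

(** Since [Gloc <= 1], the squared gradient norm is at most [Gloc]; the second order term is thus
    linear in the slope and is absorbed for every step size. *)
Lemma local_step_comparator m w :
  enorm (w - eta *: gradFloc x m w - U *: ws) ^+ 2
  <= enorm (w - U *: ws) ^+ 2 + 2 * eta * expR (- lam - 1)
     - 2 * eta * lam * ((11 / 50) * Gloc m w + misloc m w).
Proof.
rewrite addrAC [leLHS]sqr_enormD enormN enormZ dotvNr dotvZr exprMn.
rewrite [dotv (_ - _) _]dotvC dotvDr dotvNr dotvZr ger0_norm; last exact: ltW.
have h1 := dotv_gradFloc_self lam m w lam0.
have h2 := ler_wpM2l U0 (dotv_gradFloc_ws m w).
have h3 : enorm (gradFloc x m w) ^+ 2 <= Gloc m w.
  have := enorm_gradFloc_le m w; have := Gloc_le1 m w.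
  have := Gloc_ge0 m w; have := enorm_ge0 (gradFloc x m w); nra.
have h4 := ler_wpM2l (ltW (mulr_gt0 eta0 eta0)) h3.
have h2' : U * dotv (gradFloc x m w) ws <= - ((61 / 50) * lam + eta / 2) * Gloc m w.
  by rewrite -Ug; lra.
have := ler_wpM2l (ltW eta0) h1; have := ler_wpM2l (ltW eta0) h2'.
lra.
Qed.

(** Only the gain of the first step is kept, as it is taken at the shared iterate [w]; the
    nonnegative gains of later steps are dropped. *)
Lemma local_iter_comparator m w :
  enorm (local_iter x eta K m w - U *: ws) ^+ 2
  <= enorm (w - U *: ws) ^+ 2 + 2 * eta * expR (- lam - 1) * K%:R
     - 2 * eta * lam * ((11 / 50) * Gloc m w + misloc m w).
Proof.
rewrite /local_iter; case: K K0 => // k _.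
elim: k => [|k IH]; first by rewrite mulr1; exact: local_step_comparator.
rewrite iterS; apply: le_trans (local_step_comparator m _) _.
rewrite (natrD _ 1 k.+1).
set v := iter _ _ _; rewrite -/v in IH.
have : 0 <= 2 * eta * lam * ((11 / 50) * Gloc m v + misloc m v).
  have G0 := Gloc_ge0 m v; have B0 := misloc_ge0 m v.
  by rewrite mulr_ge0 // ?mulr_ge0 ?(ltW eta0) //; lra.
by move: IH; lra.
Qed.

Lemma round_comparator (psi : R) w :
  psi <= 1 / (2 * M%:R * n%:R) -> 7 * psi < Fglob x w ->
  enorm (round x eta K w - U *: ws) ^+ 2
  <= enorm (w - U *: ws) ^+ 2
     - 2 * eta * (lam * psi - K%:R * expR (- lam - 1)).
Proof.
move=> psin bad; rewrite /round avgB //.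
apply: le_trans (sqr_enorm_avg_le _ _ M0) _.
apply: le_trans (avg_le _ _ _ (local_iter_comparator ^~ w)) _.
rewrite big_split /= mulrDr avg_const //.
rewrite sumrN -mulr_sumr big_split /= -mulr_sumr.
have -> a b c : M%:R^-1 * - (a * (11 / 50 * b + c))
    = - (a * (11 / 50 * (M%:R^-1 * b) + M%:R^-1 * c)) :> R by ring.
rewrite -/(Gglob w); set B := _^-1 * \sum_m misloc m w.
have B0 : 0 <= B.
  by rewrite mulr_ge0 ?invr_ge0 ?ler0n //; apply: sumr_ge0 => m _; exact: misloc_ge0.
suff : psi <= 11 / 50 * Gglob w + B.
  have a0 : 0 <= 2 * eta * lam by rewrite !mulr_ge0 // ltW.
  by move=> /(ler_wpM2l a0); lra.
have G0 := Gglob_ge0 w.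
(* A misclassified point adds at least [1 / (2 * M * n) >= psi] to [B]. Otherwise the slopes
   suffice, since [11 / 50 * (2 / 3) * 7 > 1]. *)
have [[m [i mi]]|ok] := pselect (exists m i, dotv w (x m i) < 0).
  apply: le_trans psin _; suff : 1 / (2 * M%:R * n%:R) <= B by lra.
  apply: le_trans (avg_ge M (misloc ^~ w) m (misloc_ge0 ^~ w)).
  have M0' : 0 < M%:R :> R by rewrite ltr0n.
  have n0' : 0 < n%:R :> R by rewrite ltr0n.
  rewrite (_ : 1 / _ = M%:R^-1 * (n%:R^-1 * (1 / 2))).
    rewrite ler_wpM2l ?invr_ge0 ?ler0n //.
    apply: le_trans (avg_ge n (fun i => (dotv w (x m i) < 0)%R%:R / 2) i _).
      by rewrite mi.
    by move=> j; rewrite divr_ge0.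
  by field; rewrite !gt_eqF.
have := Fglob_le_Gglob (2 / 3) w; have : 0 <= Gglob w by [].
suff h m i : 2 / 3 * logloss (dotv w (x m i)) <= slope (dotv w (x m i)).
  by move=> _ /(_ h); lra.
have := logloss_le_slope_nonneg (dotv w (x m i)).
case: leP => [_ /(_ isT)|mi]; first lra.
by case: ok; exists m, i.
Qed.

End Comparator.
End LocalGradientDescent.

(** * Bounds on the margin and on the number of unstable rounds *)

Lemma max_margin_bounds (R : realType) (M n d : nat)
  (x : 'I_M -> 'I_n -> 'rV[R]_d) (gamma : R) :
  (0 < M)%N -> (0 < n)%N -> (forall m i, enorm (x m i) <= 1) ->
  (exists w : 'rV[R]_d, forall m i, 0 < dotv w (x m i)) ->
  is_max_margin x gamma -> 0 < gamma <= 1.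
Proof.
move=> M0 n0 x1 [v vx] [[ws [ws1 wsx]] maxw].
pose m0 := Ordinal M0; pose i0 := Ordinal n0; apply/andP; split; last first.
  apply: le_trans (wsx m0 i0) _; apply: le_trans (cauchy_schwarz _ _) _.
  by rewrite ws1 mul1r.
have v0 : 0 < enorm v.
  rewrite lt_neqAle enorm_ge0 andbT eq_sym; apply/eqP => v0.
  by have := vx m0 i0; rewrite enorm_eq0 // ltxx.
have [|m [i]] := maxw ((enorm v)^-1 *: v).
  by rewrite enormZ gtr0_norm ?invr_gt0 // mulVf // gt_eqF.
by apply: lt_le_trans; rewrite dotvZl mulr_gt0 ?invr_gt0.
Qed.

(** With [X] the quotient in the logarithm, [X ^+ 4 * eta] is [(kappa / psi) ^+ 3] divided by
    [eta * kappa * psi * gamma ^+ 4 <= 1]; take logarithms and use [ln eta <= eta]. *)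
Lemma ln_time_ge (R : realType) (eta gamma kappa psi : R) :
  0 < eta -> 0 < gamma <= 1 -> 0 < kappa -> 0 < psi ->
  eta * kappa * psi <= 1 ->
  3 / 4 * ln (kappa / psi) - eta / 4
  <= ln (1 + Num.sqrt kappa / (Num.sqrt eta * gamma * psi)).
Proof.
move=> eta0 /andP[gamma0 gamma1] kappa0 psi0 small.
set X := _ / (_ * psi).
have X0 : 0 < X by rewrite divr_gt0 ?mulr_gt0 ?sqrtr_gt0.
have lnX : ln X <= ln (1 + X) by rewrite ler_ln ?posrE ?addr_gt0 //; lra.
have X2 : X ^+ 2 = kappa / (eta * gamma ^+ 2 * psi ^+ 2).
  by rewrite expr_div_n !exprMn !sqr_sqrtr ?ltW.
have kp0 : 0 < kappa / psi by rewrite divr_gt0.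
have h : (kappa / psi) ^+ 3 <= X ^+ 4 * eta.
  rewrite (_ : X ^+ 4 = (X ^+ 2) ^+ 2); last by rewrite -exprM.
  have -> : (X ^+ 2) ^+ 2 * eta
    = (kappa / psi) ^+ 3 / (eta * kappa * psi * gamma ^+ 4).
    by rewrite X2; field; rewrite !gt_eqF.
  rewrite ler_peMr ?exprn_ge0 ?(ltW kp0) // invf_ge1 ?mulr_gt0 ?exprn_gt0 //.
  by rewrite mulr_ile1 ?mulr_ge0 ?exprn_ge0 ?exprn_ile1 // ?ltW // mulr_gt0 // mulr_gt0.
have kp3 := exprn_gt0 3 kp0; have X4 := exprn_gt0 4 X0.
move: h; rewrite -ler_ln ?posrE // ?(mulr_gt0 X4) //.
rewrite [ln (X ^+ 4 * eta)]lnM ?posrE // !lnXn //.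
have := ln_sublinear eta0; lra.
Qed.

(** Serves with [kappa = K] and [omega = gamma * enorm w0], [T] being the numerator of [tau]. Up to
    the factor [gamma ^+ 2], the last claim says that the descent over [tau] rounds exceeds the
    initial squared distance to the comparator. *)
Lemma time_bound (R : realType) (eta gamma kappa psi omega : R) :
  0 < eta -> 0 < gamma <= 1 -> 1 <= kappa -> 0 < psi -> psi <= 1 / 2 ->
  eta * kappa * psi <= 1 -> 0 <= omega ->
  let lam := ln (kappa / psi) + omega + eta / 2 in
  let T := 4 * omega + 2 * Num.sqrt 2 + 2 * eta
           + ln (1 + Num.sqrt kappa / (Num.sqrt eta * gamma * psi)) in
  [/\ 0 <= lam, 0 <= T, kappa / psi * expR (- lam - 1) < lam &
      (omega + 61 / 50 * lam + eta / 2) ^+ 2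
      < 2 * T * (lam - kappa / psi * expR (- lam - 1))].
Proof.
move=> eta0 gamma01 kappa1 psi0 psi_half small omega0 lam T.
have kappa0 : 0 < kappa by lra.
have kp0 : 0 < kappa / psi by rewrite divr_gt0.
have L0 : 3 / 5 <= ln (kappa / psi).
  apply: le_trans ln2_ge _; rewrite ler_ln ?posrE //.
  by rewrite ler_pdivlMr //; lra.
(* The choice of [lam] cancels [ln (kappa / psi)] and leaves an exponent of at most [-1]. *)
have E : kappa / psi * expR (- lam - 1) <= 1 / 2.
  rewrite -[X in X * _](@lnK _ (kappa / psi)) ?posrE // -expRD.
  rewrite (_ : ln _ + _ = - (omega + eta / 2 + 1)); last by rewrite /lam; ring.
  rewrite expRN div1r lef_pV2 ?posrE ?expR_gt0 //.
  by apply: le_trans (expR_ge1Dx _); lra.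
have sqrt2 : 7 / 5 <= Num.sqrt 2 :> R.
  by rewrite -ler_sqr ?nnegrE ?sqrtr_ge0 // ?sqr_sqrtr //; lra.
have TL := ln_time_ge _ _ _ _ _ eta0 gamma01 kappa0 psi0 small.
have HT : 3 / 4 * ln (kappa / psi) + 7 / 2 * (omega + eta / 2) + 14 / 5 <= T.
  by rewrite /T; lra.
move: E; set E := _ * expR _ => HE; move: HT HE.
rewrite (_ : _ + 61 / 50 * lam + _
  = 61 / 50 * ln (kappa / psi) + 111 / 50 * (omega + eta / 2)); last first.
  by rewrite /lam; field.
have b0 : 0 <= omega + eta / 2 by lra.
move: L0 b0; rewrite (_ : lam = ln (kappa / psi) + (omega + eta / 2)); last first.
  by rewrite /lam addrA.
move: (ln _) (omega + _) => L b L0 b0 HT HE.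
have L2 : 3 / 5 * L <= L ^+ 2 by rewrite expr2; nra.
have Lb : 0 <= L * b by nra.
have b2 : 0 <= b ^+ 2 by rewrite sqr_ge0.
split; [lra|lra|lra|].
(* A quadratic inequality in [L] and [b]: the [L ^+ 2] terms compare by [(61 / 50) ^+ 2 < 3 / 2],
   and [3 / 5 <= L] pays for the constant [- 14 / 5]. *)
apply: lt_le_trans (_ : 2 * (3 / 4 * L + 7 / 2 * b + 14 / 5) * (L + b - 1 / 2) <= _).
  by nra.
rewrite ler_pM //; lra.
Qed.

(** The inequality [tau < r%:R] is strict because at equality the informal bound is infinite,
    whereas division by zero yields [0] here. *)
Theorem theorem4p2 (R : realType) (M n d : nat) (x : 'I_M -> 'I_n -> 'rV[R]_d)
  (w0 : 'rV[R]_d) (eta : R) (K : nat) (gamma : R) :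
  (0 < M)%N -> (0 < n)%N -> (0 < K)%N -> 0 < eta ->
  (forall m i, enorm (x m i) <= 1) ->
  (exists w : 'rV[R]_d, forall m i, 0 < dotv w (x m i)) ->
  is_max_margin x gamma ->
  let psi := Num.min (gamma / (140 * eta * K%:R * M%:R)) (1 / (2 * M%:R * n%:R)) in
  let tau := (4 * gamma * enorm w0 + 2 * Num.sqrt 2 + 2 * eta
              + ln (1 + Num.sqrt K%:R / (Num.sqrt eta * gamma * psi)))
             / (eta * gamma ^+ 2 * psi) in
  forall r : nat, tau < r%:R ->
    Fglob x (localGD x eta K w0 r) <= 16 / (eta * gamma ^+ 2 * K%:R * (r%:R - tau)).
Proof.
move=> M0 n0 K0 eta0 x1 sep margin psi tau r tau_r.
have gamma01 := max_margin_bounds _ _ _ _ _ _ M0 n0 x1 sep margin.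
have /andP[gamma0 gamma1] := gamma01.
have [[ws [ws1 wsx]] _] := margin.
have M1 : 1 <= M%:R :> R by rewrite ler1n.
have n1 : 1 <= n%:R :> R by rewrite ler1n.
have K1 : 1 <= K%:R :> R by rewrite ler1n.
have [M0' n0' K0'] : [/\ 0 < M%:R :> R, 0 < n%:R :> R & 0 < K%:R :> R].
  by split; lra.
have psi0 : 0 < psi by rewrite lt_min !divr_gt0 ?mulr_gt0.
have psi1 : psi <= gamma / (140 * eta * K%:R * M%:R) by rewrite ge_min lexx.
have psi2 : psi <= 1 / (2 * M%:R * n%:R) by rewrite ge_min lexx orbT.
have psi_half : psi <= 1 / 2.
  apply: le_trans psi2 _; rewrite !div1r lef_pV2 ?posrE ?mulr_gt0 //.
  by have : 1 <= M%:R * n%:R :> R; [rewrite mulr_ege1|lra].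
have small : eta * K%:R * psi <= 1.
  have eKp : 0 < eta * K%:R * psi by rewrite !mulr_gt0.
  have : 140 * (eta * K%:R * M%:R * psi) <= gamma.
    by move: psi1; rewrite ler_pdivlMr ?mulr_gt0 //; lra.
  have := ler_wpM2l (ltW eKp) M1; lra.
have omega0 : 0 <= gamma * enorm w0 by rewrite mulr_ge0 ?enorm_ge0 // ltW.
have := time_bound _ _ _ _ _ _ eta0 gamma01 K1 psi0 psi_half small omega0.
set lam := ln _ + _ + _; set T := (4 * _ + _ + _ + _) => - [lam0 T0 Elam Tlam].
have den0 : 0 < eta * gamma ^+ 2 * psi by rewrite !mulr_gt0 ?exprn_gt0.
have tauE : tau * (eta * gamma ^+ 2 * psi) = T.
  by rewrite /tau divfK ?gt_eqF // /T mulrA.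
have tau0 : 0 <= tau.
  by rewrite -(pmulr_lge0 _ den0) tauE.
pose W s := localGD x eta K w0 s.
have [s [s_tau Fs]] : exists s : nat, s%:R <= tau /\ Fglob x (W s) <= 7 * psi.
  apply: contrapT => nos.
  have bad s : s%:R <= tau -> 7 * psi < Fglob x (W s).
    move=> st; rewrite ltNge; apply/negP => Fs; apply: nos.
    by exists s.
  pose U := (61 / 50 * lam + eta / 2) / gamma.
  have Ug : U * gamma = 61 / 50 * lam + eta / 2 by rewrite divfK // gt_eqF.
  have U0 : 0 <= U by rewrite divr_ge0 ?(ltW gamma0) //; lra.
  (* Every round up to the integer part of [tau] is bad, so strictly more than [tau] rounds decrease
     the distance. *)
  pose Rn := (Num.trunc tau).+1.
  have tauR : tau < Rn%:R by exact: truncnS_gt.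
  have dist j : (j <= Rn)%N -> enorm (W j - U *: ws) ^+ 2
      <= (enorm w0 + U) ^+ 2 - 2 * eta * (lam * psi - K%:R * expR (- lam - 1)) * j%:R.
    elim: j => [_|j IH jR].
      rewrite mulr0 subr0 lerXn2r ?nnegrE ?addr_ge0 ?enorm_ge0 //.
      apply: le_trans (enorm_triangle _ _) _.
      by rewrite enormN enormZ ger0_norm // ws1 mulr1.
    have jt : j%:R <= tau.
      apply: le_trans (_ : (Num.trunc tau)%:R <= _); first by rewrite ler_nat -ltnS.
      by have /andP[] := truncn_itv tau0.
    have := round_comparator M0 n0 x1 _ _ _ _ eta0 K0 wsx _ _
      lam0 U0 Ug _ _ psi2 (bad j jt).
    rewrite /W /localGD iterS -/(localGD x eta K w0 j) -/(W j) -natr1.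
    have := IH (ltnW jR); lra.
  have := le_trans (sqr_ge0 _) (dist Rn (leqnn _)); rewrite subr_ge0.
  move=> /(ler_wpM2l (sqr_ge0 gamma)).
  (* Scaling by [gamma ^+ 2] replaces [U] by the explicit [U * gamma] and leads to a contradiction
     with [Tlam]. *)
  have -> : gamma ^+ 2 * (enorm w0 + U) ^+ 2
      = (gamma * enorm w0 + 61 / 50 * lam + eta / 2) ^+ 2.
    by rewrite -exprMn -(addrA (gamma * _)) -Ug; congr (_ ^+ 2); ring.
  have -> : gamma ^+ 2 * (2 * eta * (lam * psi - K%:R * expR (- lam - 1)) * Rn%:R)
      = 2 * (Rn%:R * (eta * gamma ^+ 2 * psi))
          * (lam - K%:R / psi * expR (- lam - 1)).
    by field; rewrite gt_eqF.
  rewrite leNgt => /negP; apply; apply: lt_trans Tlam _.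
  rewrite ltr_pM2r ?subr_gt0 // ltr_pM2l // -tauE ltr_pM2r // !mulr_gt0 ?exprn_gt0 //.
set a := eta * K%:R * gamma ^+ 2 / 16.
have a0 : 0 < a by rewrite divr_gt0 ?mulr_gt0 ?exprn_gt0.
(* The reciprocal loss grows by at least [a] per round, stated as a product to avoid division; the
   first conjunct lets the descent be applied again. *)
have stable j : Fglob x (W (s + j)%N) <= 7 * psi
    /\ a * j%:R * Fglob x (W (s + j)%N) <= 1.
  elim: j => [|j [Fj aj]]; first by rewrite addn0 mulr0 mul0r.
  have F0 := Fglob_ge0 (W (s + j)%N) (x := x).
  have := round_descent_stable M0 n0 x1 _ _ _ _ eta0 gamma0 K0 ws1 wsx _ _
    gamma1 psi1 psi2 Fj.
  rewrite addnS /W /localGD iterS -!/(localGD x eta K w0 _) -!/(W _) -/a.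
  move: F0 Fj aj; move: (Fglob x (W (s + j)%N)) => F F0 Fj aj.
  move: (Fglob x _) => F' FF'.
have aF0 := mulr_ge0 (ltW a0) F0.
have aFF := mulr_ge0 (ltW a0) (sqr_ge0 F).
  split; first lra.
  have j0 : 0 <= a * j.+1%:R by rewrite mulr_ge0 // ltW.
  apply: le_trans (ler_wpM2l j0 FF') _; rewrite -natr1.
  (* With [q <= 1], the product [(q + y) * (1 - y)] is at most [1 - y ^+ 2] if [y <= 1], and
     nonpositive otherwise. *)
  have -> : a * (j%:R + 1) * (F - a * F ^+ 2)
    = (a * j%:R * F + a * F) * (1 - a * F) by ring.
  have q0 : 0 <= a * j%:R * F by rewrite -mulrA mulrCA mulr_ge0.
  move: (a * j%:R * F) (a * F) aF0 aj q0 => q y y0 q1 q0.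
  by have [y1|y1] := leP y 1; nra.
have sr : (s < r)%N by rewrite -(ltr_nat R); exact: le_lt_trans s_tau tau_r.
have [_] := stable (r - s)%N; rewrite subnKC ?(ltnW sr) //.
rewrite natrB ?(ltnW sr) // -/(W r) => h.
rewrite ler_pdivlMr ?mulr_gt0 ?exprn_gt0 ?subr_gt0 //.
have : a * (r%:R - tau) * Fglob x (W r) <= 1.
  by apply: le_trans h; rewrite ler_wpM2r ?Fglob_ge0 // ler_wpM2l ?(ltW a0) //; lra.
by rewrite /a; lra.
Qed.
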